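(* Let $\mathcal{M}$ be a 7-orbit map whose truncation $\mathrm{Tr}(\mathcal{M})$ is again a 7-orbit map. Then one of the following holds. (i) $\mathcal{M}$ is of type $7_K$ and $\mathrm{Tr}(\mathcal{M})$ is of type $7_J$; (ii) $\mathcal{M}$ is of type $7_L$ and $\mathrm{Tr}(\mathcal{M})$ is of type $7_{J_p}$.
   Context: A map $\mathcal{M}$ is a 2-cell embedding of a connected graph on a surface. Its flags are the triangles of the barycentric subdivision of $\mathcal{M}$, each identified with a triple $(\Phi_0,\Phi_1,\Phi_2)$ of a mutually incident vertex, edge and face; $\mathcal{F}(\mathcal{M})$ is the set of flags. For $i\in\{0,1,2\}$ let $s_i$ be the permutation of $\mathcal{F}(\mathcal{M})$ (acting on the right) sending each flag $\Phi$ to its $i$-adjacent flag $\Phi^{s_i}=\Phi^i$ (the neighbouring triangle differing from $\Phi$ only in the entry $\Phi_i$). The $s_i$ are fixed-point free involutions, $s_0s_2=s_2s_0$ is a fixed-point free involution, and $\langle s_0,s_1,s_2\rangle$ is transitive on $\mathcal{F}(\mathcal{M})$. The automorphism group $\Gamma(\mathcal{M})$ is (identified with) the group of permutations of $\mathcal{F}(\mathcal{M})$ commuting with $s_0,s_1,s_2$; it acts freely on flags. $\mathcal{M}$ is a $k$-orbit map if $\Gamma(\mathcal{M})$ has exactly $k$ orbits on $\mathcal{F}(\mathcal{M})$. The $s_i$ act on the set $\mathrm{Orb}(\mathcal{M})$ of flag-orbits by $\mathcal{O}_\Phi\cdot s_i=\mathcal{O}_{\Phi^{s_i}}$. Symmetry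 type graph: $T(\mathcal{M})$ has vertex set $\mathrm{Orb}(\mathcal{M})$, with an edge of colour $i$ joining two distinct orbits interchanged by $s_i$, and a semi-edge of colour $i$ at each orbit fixed by $s_i$. A type with $k$ vertices is given below by a triple $(\sigma_0,\sigma_1,\sigma_2)$ of permutations of $\{1,\dots,k\}$ in cycle notation: $\mathcal{M}$ is of that type iff there is a bijection $\mathrm{Orb}(\mathcal{M})\to\{1,\dots,k\}$ carrying the action of $s_i$ to $\sigma_i$ for $i=0,1,2$. (For $\mathrm{Tr}(\mathcal{M})$, the involutions $r_i$ below play the role of $s_i$.) Truncation: $\mathrm{Tr}(\mathcal{M})$ is the map on the same surface with flag set $\mathcal{F}(\mathcal{M})\times\{0,1,2\}$ and flag adjacencies $r_0,r_1,r_2$ given by $(\Phi,0)r_0=(\Phi^{s_1},0)$, $(\Phi,0)r_1=(\Phi^{s_2},0)$, $(\Phi,0)r_2=(\Phi,2)$; $(\Phi,1)r_0=(\Phi^{s_0},1)$, $(\Phi,1)r_1=(\Phi,2)$, $(\Phi,1)r_2=(\Phi^{s_2},1)$; $(\Phi,2)r_0=(\Phi^{s_1},2)$, $(\Phi,2)r_1=(\Phi,1)$, $(\Phi,2)r_2=(\Phi,0)$. Types on $\{1,\dots,7\}$: $7_J$: $\sigma_0=(1\,5)(2\,6)(3\,4)$, $\sigma_1=(2\,3)(6\,7)$, $\sigma_2=(1\,2)(5\,6)$. $7_{J_p}$: $\sigma_0=(1\,6)(2\,5)(3\,4)$, $\sigma_1=(2\,3)(6\,7)$, $\sigma_2=(1\,2)(5\,6)$.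 $7_K$: $\sigma_0=(1\,4)(2\,6)(3\,7)$, $\sigma_1=(1\,5)(2\,6)(3\,4)$, $\sigma_2=(2\,3)(6\,7)$. $7_L$: $\sigma_0=(1\,4)(2\,7)(3\,6)$, $\sigma_1=(1\,6)(2\,5)(3\,4)$, $\sigma_2=(2\,3)(6\,7)$. *)

(* Defs.v *)
From mathcomp Require Import all_boot fingroup perm.
From mathcomp Require Import boolp classical_sets functions cardinality.

Set Implicit Arguments.
Unset Strict Implicit.
Unset Printing Implicit Defensive.

Local Open Scope classical_set_scope.
Local Open Scope card_scope.

Definition c0 : 'I_3 := @Ordinal 3 0 isT.
Definition c1 : 'I_3 := @Ordinal 3 1 isT.
Definition c2 : 'I_3 := @Ordinal 3 2 isT.

(* A map is given by its flags and their i-adjacencies, [adj i] being the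
   involution s_i. The flag set need not be finite. *)
Record surface_map : Type := SurfaceMap {
  flag : Type;
  adj : 'I_3 -> flag -> flag;
  flag_inhabited : inhabited flag;
  adjK : forall i, involutive (adj i);
  adj_free : forall i (Phi : flag), adj i Phi <> Phi;
  adj02C : forall Phi : flag, adj c0 (adj c2 Phi) = adj c2 (adj c0 Phi);
  adj02_free : forall Phi : flag, adj c2 (adj c0 Phi) <> Phi;
  (* transitivity of the group generated by the involutions s_i *)
  adj_trans : forall Phi Psi : flag,
    exists w : seq 'I_3, foldl (fun X i => adj i X) Phi w = Psi
}.

Definition automorphism (M : surface_map) (gamma : flag M -> flag M) : Prop :=
  bijective gamma /\ forall i Phi, gamma (adj i Phi) = adj i (gamma Phi).

Definition flag_orbit (M : surface_map) (Phi : flag M) : set (flag M) :=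
  [set Psi | exists2 gamma, automorphism gamma & gamma Phi = Psi].

Definition Orb (M : surface_map) : set (set (flag M)) := range (@flag_orbit M).

Arguments Orb : clear implicits.

Definition is_korbit (k : nat) (M : surface_map) : Prop := Orb M #= `I_k.

(* The condition on [b] uses that s_i sends the orbit of Phi to the orbit of
   [adj i Phi]. *)
Definition has_type (k : nat) (M : surface_map) (sigma : 'I_3 -> {perm 'I_k}) : Prop :=
  exists b : set (flag M) -> 'I_k,
    set_bij (Orb M) [set: 'I_k] b /\
    forall i (Phi : flag M),
      b (flag_orbit (adj i Phi)) = sigma i (b (flag_orbit Phi)).

Definition tr_adj (M : surface_map) (i : 'I_3) (x : flag M * 'I_3) : flag M * 'I_3 :=
  let: (Phi, j) := x in
  match val j, val i with
  | 0, 0 => (adj c1 Phi, c0)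
  | 0, 1 => (adj c2 Phi, c0)
  | 0, _ => (Phi, c2)
  | 1, 0 => (adj c0 Phi, c1)
  | 1, 1 => (Phi, c2)
  | 1, _ => (adj c2 Phi, c1)
  | _, 0 => (adj c1 Phi, c2)
  | _, 1 => (Phi, c1)
  | _, _ => (Phi, c0)
  end.

Lemma c3P (P : 'I_3 -> Prop) : P c0 -> P c1 -> P c2 -> forall i, P i.
Proof.
move=> P0 P1 P2 [[|[|[|//]]] Hi].
- by rewrite (_ : Ordinal Hi = c0) //; apply: val_inj.
- by rewrite (_ : Ordinal Hi = c1) //; apply: val_inj.
- by rewrite (_ : Ordinal Hi = c2) //; apply: val_inj.
Qed.

Section Truncation.
Variable M : surface_map.
Local Notation r := (@tr_adj M).

Lemma tr_flag_inhabited : inhabited (flag M * 'I_3).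
Proof. by case: (flag_inhabited M) => Phi; exact: (inhabits (Phi, c0)). Qed.

Lemma tr_adjK i : involutive (r i).
Proof.
move=> [Phi j]; elim/c3P: i; elim/c3P: j; by rewrite /tr_adj /= ?adjK.
Qed.

Lemma tr_adj_free i x : r i x <> x.
Proof.
case: x => Phi j; elim/c3P: i; elim/c3P: j; rewrite /tr_adj /=.
all: by [case=> /adj_free | case].
Qed.

Lemma tr_adj02C x : r c0 (r c2 x) = r c2 (r c0 x).
Proof. by case: x => Phi j; elim/c3P: j; rewrite /tr_adj /= ?adj02C. Qed.

Lemma tr_adj02_free x : r c2 (r c0 x) <> x.
Proof.
case: x => Phi j; elim/c3P: j; rewrite /tr_adj /=.
all: by [case=> /adj02_free | case].
Qed.

Lemma tr_adj_trans x y :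
  exists w : seq 'I_3, foldl (fun X i => r i X) x w = y.
Proof.
pose conn x y := exists w : seq 'I_3, foldl (fun X i => r i X) x w = y.
have connT a b c : conn a b -> conn b c -> conn a c.
  by move=> [v <-] [w <-]; exists (v ++ w); rewrite foldl_cat.
have to0 Phi j : conn (Phi, j) (Phi, c0).
  elim/c3P: j; [by exists [::] | by exists [:: c1; c2] | by exists [:: c2]].
have from0 Phi j : conn (Phi, c0) (Phi, j).
  elim/c3P: j; [by exists [::] | by exists [:: c2; c1] | by exists [:: c2]].
have step i Phi : conn (Phi, c0) (adj i Phi, c0).
  elim/c3P: i.
  - by exists [:: c2; c1; c0; c1; c2].
  - by exists [:: c0].
  - by exists [:: c1].
case: x y => [Phi i] [Psi j]; apply: (connT _ _ _ (to0 Phi i)).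
apply: (connT _ _ _ _ (from0 Psi j)); have [w <-] := adj_trans Phi Psi.
elim: w Phi => [|k w IH] Phi /=; first by exists [::].
exact: (connT _ _ _ (step k Phi) (IH _)).
Qed.

End Truncation.

Definition Tr (M : surface_map) : surface_map :=
  @SurfaceMap (flag M * 'I_3)%type (@tr_adj M) (tr_flag_inhabited M) (@tr_adjK M)
    (@tr_adj_free M) (@tr_adj02C M) (@tr_adj02_free M) (@tr_adj_trans M).

(* The transposition (a b) of {1,...,7}, the label a being represented by the
   element a - 1 of 'I_7; only used for 1 <= a, b <= 7. *)
Definition tr7 (a b : nat) : {perm 'I_7} := tperm (inord a.-1) (inord b.-1).

Definition triple (k : nat) (s0 s1 s2 : {perm 'I_k}) (i : 'I_3) : {perm 'I_k} :=
  match val i with 0 => s0 | 1 => s1 | _ => s2 end.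

Definition type7J : 'I_3 -> {perm 'I_7} :=
  triple (tr7 1 5 * tr7 2 6 * tr7 3 4)%g
         (tr7 2 3 * tr7 6 7)%g
         (tr7 1 2 * tr7 5 6)%g.

Definition type7Jp : 'I_3 -> {perm 'I_7} :=
  triple (tr7 1 6 * tr7 2 5 * tr7 3 4)%g
         (tr7 2 3 * tr7 6 7)%g
         (tr7 1 2 * tr7 5 6)%g.

Definition type7K : 'I_3 -> {perm 'I_7} :=
  triple (tr7 1 4 * tr7 2 6 * tr7 3 7)%g
         (tr7 1 5 * tr7 2 6 * tr7 3 4)%g
         (tr7 2 3 * tr7 6 7)%g.

Definition type7L : 'I_3 -> {perm 'I_7} :=
  triple (tr7 1 4 * tr7 2 7 * tr7 3 6)%g
         (tr7 1 6 * tr7 2 5 * tr7 3 4)%g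
         (tr7 2 3 * tr7 6 7)%g.

(* Main.v *)
From mathcomp Require Import all_boot fingroup perm.
From mathcomp Require Import boolp classical_sets functions cardinality.
Require Import Defs.

Set Implicit Arguments.
Unset Strict Implicit.
Unset Printing Implicit Defensive.

(** Suppose that [M] and [Tr M] both have seven flag-orbits.  An automorphism of
    [Tr M] that sends some flag [(Phi, c0)] to a flag [(Psi, c0)] preserves the
    whole level [c0], because [r_0], [r_1] and the word [r_2 r_1 r_0 r_1 r_2]
    act on that level as [s_1], [s_2] and [s_0]; it therefore comes from an
    automorphism of [M] ([level0_orbit]).  So [Phi |-> (Phi, c0)] induces an
    injection of the flag-orbits of [M] into those of [Tr M], which is a
    bijection since both sets have seven elements ([level0_label]).  After this
    identification of the two orbit sets, the action of the [s_i] is determined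
    by that of the [r_i]: [s_1], [s_2] and [s_0] act as [r_0], [r_1] and
    [r_2 r_1 r_0 r_1 r_2].

    It remains to classify the transitive actions of [r_0, r_1, r_2] on seven
    points.  Besides being involutions, they satisfy [r_0 r_2 = r_2 r_0] and,
    every vertex of a truncation having degree three,
    [r_1 r_2 r_1 = r_2 r_1 r_2].  Seven being odd, the commuting involutions
    [r_0] and [r_2] have a common fixed point ([common_fixed_point]).  Walking
    from this point, the relations and the bound of seven points force every
    step, up to one binary choice ([seven_point_action]).  The two outcomes are
    the types [7_J] and [7_Jp], and the formulas for the [s_i] turn these
    into [7_K] and [7_L]. *)

(** * Involutions on finite sets *)

(** The other points of [A] come in pairs [{x, g x}]. *)
Lemma odd_card_fixpoints (X : finType) (g : X -> X) (A : {set X}) :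
    involutive g -> {in A, forall x, g x \in A} ->
  odd #|[set x in A | g x == x]| = odd #|A|.
Proof.
move=> gK; have [n] := ubnP #|A|; elim: n => // n IH in A * => lt_An gA.
have [x /andP[Ax gx] | fixA] := pickP [pred x in A | g x != x]; last first.
  congr (odd _); apply: eq_card => x; rewrite !inE.
  by case Ax: (x \in A); have /= := fixA x; rewrite // Ax /= => /negbFE.
have Agx : g x \in A :\ x by rewrite !inE gx gA.
(* Induction: the pair [{x, g x}] is removed from [A] *)
have cardA : #|A| = #|A :\ x :\ g x|.+2.
  by rewrite (cardsD1 x) Ax (cardsD1 (g x)) Agx.
rewrite cardA /= negbK -(IH (A :\ x :\ g x)).
- congr (odd _); apply: eq_card => y; rewrite !inE.
  have [->|_] := eqVneq y (g x); first by
    rewrite gK [x == _]eq_sym (negPf gx) andbF.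
  by have [->|] := eqVneq y x; rewrite // (negPf gx) andbF.
- by rewrite cardA ltnS in lt_An; apply: ltn_trans lt_An.
move=> y; rewrite !inE => /and3P[ygx yx Ay].
by rewrite (inj_eq (inv_inj gK)) yx (can2_eq gK gK) ygx gA.
Qed.

Definition stable (X : eqType) (g : X -> X) (s : seq X) :=
  all (fun t => g t \in s) s.

Lemma stable_mem (X : eqType) (g : X -> X) (s : seq X) (t : X) :
  involutive g -> stable g s -> (g t \in s) = (t \in s).
Proof.
move=> gK /allP gs; apply/idP/idP; last exact: gs.
by move/gs; rewrite gK.
Qed.

Lemma stable_cons (X : eqType) (g : X -> X) (s : seq X) (t : X) :
  g t = t -> stable g s -> stable g (t :: s).
Proof.
move=> gt /allP gs; rewrite /stable /= gt mem_head /=.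
by apply/allP => y /gs; rewrite inE orbC => ->.
Qed.

Lemma stable_cons2 (X : eqType) (g : X -> X) (s : seq X) (t t' : X) :
  involutive g -> g t = t' -> stable g s -> stable g [:: t, t' & s].
Proof.
move=> gK <- /allP gs; rewrite /stable /= gK !inE !eqxx !orbT /=.
by apply/allP => y /gs; rewrite !inE => ->; rewrite !orbT.
Qed.

(** * Transitive actions on seven points *)

Section Classification.

Variables (X : finType) (r : 'I_3 -> X -> X).
Local Notation a := (r c0).
Local Notation b := (r c1).
Local Notation c := (r c2).
Hypothesis cardX : #|X| = 7.
Hypothesis rK : forall i, involutive (r i).
Hypothesis acC : forall x, a (c x) = c (a x).
Hypothesis braid : forall x, b (c (b x)) = c (b (c x)).
Hypothesis r_trans : forall x y, exists w, foldl (fun t i => r i t) x w = y.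

Lemma size_uniq_le7 (s : seq X) : uniq s -> size s <= 7.
Proof. by move/card_uniqP=> <-; rewrite -cardX max_card. Qed.

(** Transitivity leaves no proper nonempty stable set, so a stable [x :: s]
    contains all seven points.  This is what forbids the walk to close up too
    early. *)
Lemma size_stable_ge6 (x : X) (s : seq X) :
  stable a (x :: s) -> stable b (x :: s) -> stable c (x :: s) -> 6 <= size s.
Proof.
move=> sa sb sc; rewrite -ltnS -[7]cardX.
have full y : y \in x :: s.
  have [w <-] := r_trans x y.
  elim/last_ind: w => [|w i IH]; first exact: mem_head.
  by rewrite -cats1 foldl_cat /= stable_mem //; elim/c3P: i.
apply: leq_trans (card_size (x :: s)).
by apply: subset_leq_card; apply/fintype.subsetP => y _.
Qed.

(** The number of fixed points of [c] is odd, and [a], which commutes with [c],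
    permutes them; hence [a] fixes one of them. *)
Lemma common_fixed_point : exists x, a x = x /\ c x = x.
Proof.
pose F := [set x in [set: X] | c x == x].
have oddF : odd #|F|.
  by rewrite odd_card_fixpoints ?cardsT ?cardX // => x _; rewrite inE.
have aF : {in F, forall x, a x \in F}.
  by move=> x; rewrite !inE -acC => /eqP->; rewrite eqxx.
have := odd_card_fixpoints (rK c0) aF; rewrite oddF.
have [->|[x]] := set_0Vmem [set x in F | a x == x]; first by rewrite cards0.
by rewrite !inE => /andP[/eqP cx /eqP ax] _; exists x.
Qed.

(** The second half of the walk.  Three points [S] have been visited, [a] joins
    two of them to the new pair [{u, v}] exchanged by [c], and [b] leads from [u]
    to a sixth point [w].  If [c] moved [w], the braid relation would make the
    orbit of [u] under [b] and [c] consist of six points outside [S], nine points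
    in all; so [c] fixes [w], and the only place left for [a w] is the seventh
    point, where [b] and [c] have to be trivial. *)
Lemma forced_tail (S : seq X) u v (w := b u) :
    size S = 3 -> uniq [:: u, v & S] ->
    stable b S -> stable c S -> stable a [:: u, v & S] ->
    c u = v -> w \notin [:: u, v & S] ->
  [/\ uniq [:: v, u, w, a w & S], b v = v, c w = w, b (a w) = a w
    & c (a w) = a w].
Proof.
move=> sizeS U sb sc sa cu wN.
have bw : b w = u by rewrite rK.
have [uNvS /andP[vNS US]] := andP U.
have [uv uS] := norP uNvS; have [_ /norP[wv wS]] := norP wN.
have sc5 : stable c [:: u, v & S] by apply: stable_cons2.
have cw : c w = w.
  apply/eqP; apply: contraT => cw.
  have bv : b v = c (b (c w)) by rewrite -braid bw cu.
  have bvN : b v \notin [:: c w, w, u, v & S].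
    rewrite !inE !negb_or [b v \in S]stable_mem // vNS andbT.
    apply/and4P; split.
    - rewrite bv (inj_eq (inv_inj (rK c2))) (can2_eq (rK c1) (rK c1)).
      by rewrite bw (can2_eq (rK c2) (rK c2)) cu.
    - by rewrite (inj_eq (inv_inj (rK c1))) eq_sym.
    - by rewrite -bw (inj_eq (inv_inj (rK c1))) eq_sym.
    - rewrite bv -cu (inj_eq (inv_inj (rK c2))) -bw.
      by rewrite (inj_eq (inv_inj (rK c1))).
  (* Eight of the nine points suffice for the contradiction. *)
  have U8 : uniq [:: b v, c w, w, u, v & S].
    rewrite (cons_uniq (b v)) bvN (cons_uniq (c w)) (cons_uniq w) wN U !andbT.
    by rewrite inE (negPf cw) stable_mem.
  by have := size_uniq_le7 U8; rewrite /= sizeS.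
have bv : b v = v by rewrite -cu -bw braid cw bw.
have sb6 : stable b [:: w, u, v & S].
  by apply: stable_cons2 => //; apply: stable_cons.
have caw : c (a w) = a w by rewrite -acC cw.
have awN : a w \notin [:: w, u, v & S].
  rewrite inE stable_mem // (negPf wN) orbF; apply/eqP => aw.
  suff: 6 <= size [:: u, v & S] by rewrite /= sizeS.
  by apply: (@size_stable_ge6 w) => //; apply: stable_cons.
have U7 : uniq [:: a w, w, u, v & S].
  by rewrite (cons_uniq (a w)) awN (cons_uniq w) wN.
have full t : t \in [:: a w, w, u, v & S].
  apply: contraT => tN; have /size_uniq_le7 : uniq [:: t, a w, w, u, v & S].
    by rewrite (cons_uniq t) tN.
  by rewrite /= sizeS.
split=> //.
  rewrite -(perm_uniq (s1 := rev [:: v; u; w; a w] ++ S)) //.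
  by rewrite (perm_cat2r S _ [:: v; u; w; a w]) perm_rev.
have := full (b (a w)).
by rewrite inE stable_mem // (negPf awN) orbF => /eqP.
Qed.

(** The walk starts at a common fixed point [p7] of [a] and [c], and follows [b]
    to [p6] and [c] to [p5]; the braid relation closes this triple under [b] and
    [c].  So [a] leads from [p6] and [p5] to a new pair exchanged by [c], and [b]
    must lead out of this pair at one of its ends, called [p2].  The remaining
    freedom is whether [p2] is [a p6] or [a p5]. *)
Lemma seven_point_action :
  exists p1 p2 p3 p4 p5 p6 p7, let s := [:: p1; p2; p3; p4; p5; p6; p7] in
  [/\ uniq s, map b s = [:: p1; p3; p2; p4; p5; p7; p6],
      map c s = [:: p2; p1; p3; p4; p6; p5; p7]
    & map a s = [:: p5; p6; p4; p3; p1; p2; p7] \/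
      map a s = [:: p6; p5; p4; p3; p2; p1; p7]].
Proof.
have [x [ax cx]] := common_fixed_point.
pose y := b x; pose z := c y.
(* Braid relation at the fixed point [x] of [c] *)
have bz : b z = z by rewrite /z /y braid cx.
have yx : y != x.
  apply/eqP => bx; suff: 6 <= size (Nil X) by [].
  by apply: (@size_stable_ge6 x); apply: stable_cons.
have zy : z != y.
  by apply: contraNneq yx => zy; apply/eqP; rewrite -[LHS]zy -bz zy rK.
have zx : z != x by rewrite -cx /z (inj_eq (inv_inj (rK c2))).
pose S := [:: z; y; x].
have US : uniq S by rewrite /= !inE negb_or zy zx yx.
have cy : c y = z by [].
have cz : c z = y by rewrite rK.
have by' : b y = x by rewrite rK.
have sb : stable b S by apply: stable_cons => //; apply: stable_cons2.
have sc : stable c S by apply: stable_cons2 => //; apply: stable_cons.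
pose u := a y; pose v := a z.
have cu : c u = v by rewrite -acC.
have cv : c v = u by rewrite -acC /v cz.
have uS : u \notin S.
  apply/negP => uS; suff: 6 <= size [:: y; x] by [].
  apply: (@size_stable_ge6 z) => //; rewrite /S.
  move: uS; rewrite !inE => /or3P[] /eqP ay.
  - by apply: stable_cons2; [|rewrite -ay rK|apply: stable_cons].
  - apply: stable_cons; first exact: etrans (acC y) (congr1 c ay).
    by do 2!apply: stable_cons => //.
  - by case/eqP: yx; rewrite -[y](rK c0) -/u ay ax.
have vS : v \notin S by rewrite -cu stable_mem.
have uv : u != v by rewrite (inj_eq (inv_inj (rK c0))) eq_sym.
have U5 : uniq [:: u, v & S].
  by rewrite (cons_uniq u) (cons_uniq v) inE negb_or uv uS vS US.
have U5' : uniq [:: v, u & S].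
  by rewrite (cons_uniq v) (cons_uniq u) inE negb_or eq_sym uv uS vS US.
have sa : stable a [:: u, v & S] by rewrite /stable /= !rK ax !inE !eqxx !orbT.
have sa' : stable a [:: v, u & S] by rewrite /stable /= !rK ax !inE !eqxx !orbT.
have [wN|buS] := boolP (b u \notin [:: u, v & S]).
  have [U7 bv cw bq cq] := forced_tail (erefl : size S = 3) U5 sb sc sa cu wN.
  exists v, u, (b u), (a (b u)), z, y, x; rewrite /= !rK; split=> //.
  - by rewrite bv bz bq.
  - by rewrite cv cu cw cq cx.
  - by left; rewrite ax.
have [wN|bvS] := boolP (b v \notin [:: v, u & S]).
  have [U7 bu cw bq cq] := forced_tail (erefl : size S = 3) U5' sb sc sa' cv wN.
  exists u, v, (b v), (a (b v)), z, y, x; rewrite /= !rK; split=> //.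
  - by rewrite bu bz bq.
  - by rewrite cv cu cw cq cx.
  - by right; rewrite ax.
(* If [b] kept both [u] and [v] among the five points, these would be stable. *)
suff: 6 <= size [:: v, z, y & [:: x]] by [].
apply: (@size_stable_ge6 u) => //; last exact: stable_cons2.
have bvS' : b v \in [:: u, v & S].
  by move: bvS; rewrite negbK ![_ \in [:: _, _ & _]]inE orbCA.
apply/allP => t; rewrite 2!in_cons => /or3P[/eqP->|/eqP->|tS] //.
  exact: negbNE buS.
by rewrite 2!in_cons (allP sb _ tS) !orbT.
Qed.
End Classification.

(** * The four types *)

Definition swap (m n k : nat) := if k == m then n else if k == n then m else k.

(** [tperm] and [inord] are locked or opaque to reduction, whereas [swap] computes
    on numerals. *)
Lemma tr7E m n (k : 'I_7) : 0 < m <= 7 -> 0 < n <= 7 ->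
  tr7 m n k = swap m.-1 n.-1 k :> nat.
Proof.
case: m n => [|m] [|n] //= lem len; rewrite /swap.
case: tpermP => [->|->|/eqP km /eqP kn]; rewrite ?inordK ?eqxx //.
  by case: eqP => // ->.
by move: km kn; rewrite -!val_eqE /= !inordK // => /negPf-> /negPf->.
Qed.

(** Row [i] of the table lists the values of [sigma i].  With tables, composites
    of the permutations of a type are evaluated without unfolding products of
    transpositions.  Indices start at zero: the point labelled [p] is [p - 1]. *)
Definition has_table (sigma : 'I_3 -> {perm 'I_7}) (t : seq (seq nat)) :=
  forall i (k : 'I_7), sigma i k = nth 0 (nth [::] t i) k :> nat.

Lemma type7J_table : has_table type7J
  [:: [:: 4; 5; 3; 2; 0; 1; 6]; [:: 0; 2; 1; 3; 4; 6; 5]; [:: 1; 0; 2; 3; 5; 4; 6]].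
Proof.
by move=> i [[|[|[|[|[|[|[|//]]]]]]] k7]; elim/c3P: i;
  rewrite /type7J /triple /= ?permM ?tr7E.
Qed.

Lemma type7Jp_table : has_table type7Jp
  [:: [:: 5; 4; 3; 2; 1; 0; 6]; [:: 0; 2; 1; 3; 4; 6; 5]; [:: 1; 0; 2; 3; 5; 4; 6]].
Proof.
by move=> i [[|[|[|[|[|[|[|//]]]]]]] k7]; elim/c3P: i;
  rewrite /type7Jp /triple /= ?permM ?tr7E.
Qed.

Lemma type7K_table : has_table type7K
  [:: [:: 3; 5; 6; 0; 4; 1; 2]; [:: 4; 5; 3; 2; 0; 1; 6]; [:: 0; 2; 1; 3; 4; 6; 5]].
Proof.
by move=> i [[|[|[|[|[|[|[|//]]]]]]] k7]; elim/c3P: i;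
  rewrite /type7K /triple /= ?permM ?tr7E.
Qed.

Lemma type7L_table : has_table type7L
  [:: [:: 3; 6; 5; 0; 4; 2; 1]; [:: 5; 4; 3; 2; 1; 0; 6]; [:: 0; 2; 1; 3; 4; 6; 5]].
Proof.
by move=> i [[|[|[|[|[|[|[|//]]]]]]] k7]; elim/c3P: i;
  rewrite /type7L /triple /= ?permM ?tr7E.
Qed.

Lemma tuple_labelling (X : finType) (r : 'I_3 -> X -> X)
    (sigma : 'I_3 -> {perm 'I_7}) (x0 : X) s :
    #|X| = 7 -> uniq s -> size s = 7 ->
    (forall i (k : 'I_7), r i (nth x0 s k) = nth x0 s (sigma i k)) ->
  exists2 f : X -> 'I_7, bijective f & forall i x, f (r i x) = sigma i (f x).
Proof.
move=> cardX Us ss rs.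
have full x : x \in s.
  apply: contraT => xs; have /card_uniqP /= U8 : uniq (x :: s) by rewrite /= xs.
  by have := max_card (mem (x :: s)); rewrite U8 ss cardX.
pose f x : 'I_7 := inord (index x s).
have fE x : f x = index x s :> nat by rewrite inordK // -ss index_mem.
have fK : cancel f (fun k => nth x0 s k) by move=> x; rewrite fE nth_index.
have gK : cancel (fun k : 'I_7 => nth x0 s k) f.
  by move=> k; apply: val_inj; rewrite /= fE index_uniq // ss.
exists f => [|i x]; first by exists (fun k : 'I_7 => nth x0 s k).
by rewrite -{1}(fK x) rs gK.
Qed.

Lemma action_type (X : finType) (r : 'I_3 -> X -> X) :
  #|X| = 7 -> (forall i, involutive (r i)) ->
  (forall x, r c0 (r c2 x) = r c2 (r c0 x)) ->
  (forall x, r c1 (r c2 (r c1 x)) = r c2 (r c1 (r c2 x))) ->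
  (forall x y, exists w, foldl (fun t i => r i t) x w = y) ->
  exists2 f : X -> 'I_7, bijective f &
    (forall i x, f (r i x) = type7J i (f x)) \/
    (forall i x, f (r i x) = type7Jp i (f x)).
Proof.
move=> cardX rK acC braid r_trans.
have [p1 [p2 [p3 [p4 [p5 [p6 [p7 [U]]]]]]]] :=
  seven_point_action cardX rK acC braid r_trans.
move=> [b1 b2 b3 b4 b5 b6 b7] [e1 e2 e3 e4 e5 e6 e7].
case=> -[a1 a2 a3 a4 a5 a6 a7].
all: set s := [:: p1; p2; p3; p4; p5; p6; p7] in U *.
- have rs i (k : 'I_7) : r i (nth p1 s k) = nth p1 s (type7J i k).
    by case: k => [[|[|[|[|[|[|[|//]]]]]]] k7]; elim/c3P: i;
      rewrite type7J_table.
  by have [f bij_f fr] := tuple_labelling cardX U erefl rs; exists f => //; left.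
- have rs i (k : 'I_7) : r i (nth p1 s k) = nth p1 s (type7Jp i k).
    by case: k => [[|[|[|[|[|[|[|//]]]]]]] k7]; elim/c3P: i;
      rewrite type7Jp_table.
  by have [f bij_f fr] := tuple_labelling cardX U erefl rs; exists f => //; right.
Qed.

(** The relation between the orbit actions of [M] and of [Tr M] when the
    orbits of [M] are identified with those of the level [c0] of [Tr M]. *)
Definition untruncates n (sigma tau : 'I_3 -> {perm 'I_n}) :=
  forall k, [/\ sigma c0 k = tau c2 (tau c1 (tau c0 (tau c1 (tau c2 k)))),
    sigma c1 k = tau c0 k & sigma c2 k = tau c1 k].

Lemma type7K_untruncates : untruncates type7K type7J.
Proof.
by move=> k; split; apply: val_inj;
  rewrite [LHS]type7K_table [RHS]type7J_table ?type7J_table;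
  case: k => [[|[|[|[|[|[|[|//]]]]]]]].
Qed.

Lemma type7L_untruncates : untruncates type7L type7Jp.
Proof.
by move=> k; split; apply: val_inj;
  rewrite [LHS]type7L_table [RHS]type7Jp_table ?type7Jp_table;
  case: k => [[|[|[|[|[|[|[|//]]]]]]]].
Qed.

(** * Flag-orbits *)

Lemma automorphism_comp M (g h : flag M -> flag M) :
  automorphism g -> automorphism h -> automorphism (g \o h).
Proof.
move=> [bg gE] [bh hE]; split; first exact: bij_comp.
by move=> i Phi /=; rewrite hE gE.
Qed.

Lemma automorphism_inv M (g g' : flag M -> flag M) :
  automorphism g -> cancel g g' -> cancel g' g -> automorphism g'.
Proof.
move=> [_ gE] gK g'K; split; first by exists g.
by move=> i Phi; apply: (can_inj gK); rewrite gE !g'K.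
Qed.

Lemma flag_orbit_eqP M (Phi Psi : flag M) :
  flag_orbit Phi = flag_orbit Psi <->
  exists2 gamma, automorphism gamma & gamma Phi = Psi.
Proof.
split=> [eqo | [g Ag gPhi]].
  suff: flag_orbit Phi Psi by [].
  by rewrite eqo; exists id => //; split=> //; exists id.
have [[g' gK g'K] _] := Ag; have Ag' := automorphism_inv Ag gK g'K.
apply/seteqP; split=> _ [h Ah <-].
  by exists (h \o g'); [exact: automorphism_comp | rewrite /= -gPhi gK].
by exists (h \o g); [exact: automorphism_comp | rewrite /= gPhi].
Qed.

Lemma flag_orbit_adj M i (Phi Psi : flag M) :
  flag_orbit Phi = flag_orbit Psi ->
  flag_orbit (adj i Phi) = flag_orbit (adj i Psi).
Proof.
move=> /flag_orbit_eqP[g Ag <-]; apply/flag_orbit_eqP; exists g => //.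
by have [_ ->] := Ag.
Qed.

(** A numbering of the flag-orbits, carried by the flags: this avoids handling
    sets of flags. *)
Definition orbit_label k M (l : flag M -> 'I_k) :=
  (forall j, exists Phi, l Phi = j) /\
  (forall Phi Psi, l Phi = l Psi <-> flag_orbit Phi = flag_orbit Psi).

Lemma korbit_label k M :
  is_korbit k M -> exists l : flag M -> 'I_k, orbit_label l.
Proof.
move=> /card_set_bijP[f [fun_f inj_f surj_f]].
have lt_f Phi : f (flag_orbit Phi) < k by apply: fun_f; exists Phi.
exists (fun Phi => Ordinal (lt_f Phi)); split=> [j | Phi Psi].
  have [_ [Phi _ <-] fj] := surj_f j (ltn_ord j).
  by exists Phi; apply: val_inj.
split=> [[eqf] | eqo]; last by apply: val_inj; rewrite /= eqo.
by apply: inj_f; rewrite ?inE //; [exists Phi | exists Psi].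
Qed.

Lemma orbit_label_type k M (l : flag M -> 'I_k) (sigma : 'I_3 -> {perm 'I_k}) :
  orbit_label l -> (forall i Phi, l (adj i Phi) = sigma i (l Phi)) ->
  has_type M sigma.
Proof.
move=> [surj_l lP] lE.
have [b bE] : exists b, forall Phi, b (flag_orbit Phi) = l Phi.
  have /choice[b bP] S : exists j, forall Phi, S = flag_orbit Phi -> j = l Phi.
    have [[Phi ->] | noS] := pselect (exists Phi, S = flag_orbit Phi).
      by exists (l Phi) => Psi /lP.
    have [Phi0] := flag_inhabited M.
    by exists (l Phi0) => Psi eS; case: noS; exists Psi.
  by exists b => Phi; apply: bP.
exists b; split=> [|i Phi]; last by rewrite !bE.
split=> [//|_ _ /set_mem[Phi _ <-] /set_mem[Psi _ <-]|j _].
  by rewrite !bE => /lP.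
by have [Phi <-] := surj_l j; exists (flag_orbit Phi); [exists Phi | rewrite bE].
Qed.

(** * Flag-orbits of the truncation *)

Definition walk M (w : seq 'I_3) (Phi : flag M) :=
  foldl (fun X i => adj i X) Phi w.

Lemma automorphism_walk M (g : flag M -> flag M) w Phi :
  automorphism g -> g (walk w Phi) = walk w (g Phi).
Proof. by move=> [_ gE]; elim: w Phi => //= i w IH Phi; rewrite IH gE. Qed.

(** A word in the [r_j] that acts on level [c0] as [s_i]. *)
Definition lift_walk (i : 'I_3) : seq 'I_3 :=
  match val i with 0 => [:: c2; c1; c0; c1; c2] | 1 => [:: c0] | _ => [:: c1] end.

Lemma lift_walkE M i (Phi : flag M) :
  walk (M := Tr M) (lift_walk i) (Phi, c0) = (adj i Phi, c0).
Proof. by elim/c3P: i. Qed.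

(** The flags of level [c0] are connected by words that preserve the level, and
    automorphisms commute with words. *)
Lemma level0_preserved M (g : flag (Tr M) -> flag (Tr M)) Phi Psi :
  automorphism g -> g (Phi, c0) = (Psi, c0) ->
  forall X, g (X, c0) = ((g (X, c0)).1, c0).
Proof.
move=> Ag gPhi X; have [w <-] := adj_trans Phi X.
elim/last_ind: w => [|w i IH]; first by rewrite /= gPhi.
rewrite -cats1 foldl_cat /= -lift_walkE automorphism_walk // IH.
by rewrite lift_walkE.
Qed.

(** Restricting to level [c0] inverts the extension of an automorphism [g] of [M]
    to the automorphism [(X, j) |-> (g X, j)] of [Tr M]. *)
Lemma level0_orbit M (Phi Psi : flag M) :
  @flag_orbit (Tr M) (Phi, c0) = @flag_orbit (Tr M) (Psi, c0) <->
  flag_orbit Phi = flag_orbit Psi.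
Proof.
split=> /flag_orbit_eqP[g Ag gPhi]; apply/flag_orbit_eqP; last first.
  exists (fun x => (g x.1, x.2)); last by rewrite /= gPhi.
  have [[g' gK g'K] gE] := Ag; split.
    by exists (fun x => (g' x.1, x.2)) => -[X j] /=; rewrite ?gK ?g'K.
  by move=> i [X j]; elim/c3P: i; elim/c3P: j; rewrite /= ?gE.
have [[g' gK g'K] _] := Ag; have Ag' := automorphism_inv Ag gK g'K.
have g0 := level0_preserved Ag gPhi.
have g'0 : forall X, g' (X, c0) = ((g' (X, c0)).1, c0).
  by apply: (level0_preserved (Phi := Psi) (Psi := Phi) Ag'); rewrite -gPhi gK.
exists (fun X => (g (X, c0)).1); last by rewrite gPhi.
split.
  by exists (fun X => (g' (X, c0)).1) => X; rewrite -?g0 -?g'0 ?gK ?g'K.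
by move=> i X; rewrite -lift_walkE automorphism_walk // g0 lift_walkE.
Qed.

(** The flags of level [c0] meet every orbit of [Tr M]: sending the orbit of
    [Phi] to that of [(Phi, c0)] is injective, between sets of [k] elements. *)
Lemma level0_label k M (l : flag M -> 'I_k) (m : flag (Tr M) -> 'I_k) :
  orbit_label l -> orbit_label m -> orbit_label (fun Phi => m (Phi, c0)).
Proof.
move=> [surj_l lP] [_ mP].
have m0P Phi Psi : m (Phi, c0) = m (Psi, c0) <-> flag_orbit Phi = flag_orbit Psi.
  by apply: iff_trans (mP _ _) (level0_orbit _ _).
split=> // j; have [h hK] := choice surj_l.
have inj : injective (fun j => m (h j, c0)).
  by move=> j1 j2 /m0P/lP; rewrite !hK.
by have [g _ gK] := injF_bij inj; exists (h (g j)).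
Qed.

Theorem proposition10 (M : surface_map) :
  is_korbit 7 M -> is_korbit 7 (Tr M) ->
  (has_type M type7K /\ has_type (Tr M) type7J) \/
  (has_type M type7L /\ has_type (Tr M) type7Jp).
Proof.
move=> /korbit_label[l lab_l] /korbit_label[m lab_m].
have lab_m0 := level0_label lab_l lab_m.
have [surj_m mP] := lab_m; have [s sK] := choice surj_m.
pose r i k := m (adj i (s k)).
have rE i x : m (adj i x) = r i (m x).
  by apply/mP/flag_orbit_adj/mP; rewrite sK.
have rK i : involutive (r i) by move=> k; rewrite -(sK k) -!rE adjK.
have rw w x : m (walk w x) = foldl (fun t i => r i t) (m x) w.
  by elim: w x => //= i w IH x; rewrite -rE -IH.
have acC k : r c0 (r c2 k) = r c2 (r c0 k).
  by rewrite -(sK k) -!rE adj02C.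
(* On each flag of [Tr M], both words are paths to the opposite flag of the
   hexagon around a vertex of degree three. *)
have braid k : r c1 (r c2 (r c1 k)) = r c2 (r c1 (r c2 k)).
  rewrite -(sK k) -!rE; case: (s k) => Phi j.
  by elim/c3P: j; rewrite /= ?adjK.
have trans k k' : exists w, foldl (fun t i => r i t) k w = k'.
  have [w wk] := adj_trans (s k) (s k').
  by exists w; rewrite -(sK k) -rw /walk wk.
have [f bij_f fr] := action_type (card_ord 7) rK acC braid trans.
have lab_f N (n : flag N -> 'I_7) : orbit_label n -> orbit_label (f \o n).
  move=> [surj_n nP]; split=> [j|Phi Psi]; last first.
    by rewrite -nP; split=> [/(bij_inj bij_f)|/= ->].
  have [g _ gK] := bij_f; have [Phi nPhi] := surj_n (g j).
  by exists Phi; rewrite /= nPhi.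
have adj_level0 i Phi :
    m (adj i Phi, c0) = foldl (fun t i => r i t) (m (Phi, c0)) (lift_walk i).
  by rewrite -rw lift_walkE.
have types sigma tau : untruncates sigma tau ->
    (forall i k, f (r i k) = tau i (f k)) ->
  has_type M sigma /\ has_type (Tr M) tau.
  move=> sE ftau; split.
    apply: (orbit_label_type (lab_f _ _ lab_m0)) => i Phi /=.
    by rewrite adj_level0; elim/c3P: i; have [s0 s1 s2] := sE (f (m (Phi, c0)));
      rewrite /= !ftau.
  by apply: (orbit_label_type (lab_f _ _ lab_m)) => i x /=; rewrite rE ftau.
case: fr => fr; [left | right]; apply: types fr.
  exact: type7K_untruncates.
exact: type7L_untruncates.
Qed.
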